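(* Let $F$ be a compact convex subset of $\mathbb{R}^2$ with area $1$, and let $M$ be any unit mountain with floor $F$, i.e. $M={\sf CH}((F\times\{0\})\cup\{z\})$ with $z\in\mathbb{R}^3$, $z_3=3$. For all $n\geq0$, \[Q_M(n)\geq Y_n:=\frac{2^n}{n!}\prod_{j=1}^n\frac{1}{3j-1}.\]
   Context: For a compact convex set $K\subset\mathbb{R}^3$ of volume 1 with floor $F$ (meaning $K\subset\{x_3\geq0\}$ and $K\cap(\mathbb{R}^2\times\{0\})=F\times\{0\}$), $Q_K(n)$ is the probability that $n$ independent uniform random points $U_1,\dots,U_n$ in $K$ all lie on the boundary of ${\sf CH}(\{U_1,\dots,U_n\}\cup(F\times\{0\}))$, with $Q_K(0)=1$. *)

(* Defs.v *)
From HB Require Import structures.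
From mathcomp Require Export all_boot all_order all_algebra.
From mathcomp Require Export all_classical all_reals all_analysis.
Export Order.TTheory GRing.Theory Num.Theory.
Export numFieldNormedType.Exports.

Set Implicit Arguments.
Unset Strict Implicit.
Unset Printing Implicit Defensive.

Local Open Scope classical_set_scope.
Local Open Scope ring_scope.

(* Points of the plane and of space are [(x1, x2)] and [((x1, x2), x3)], so
   that the third coordinate of [z] is [z.2]. *)
Notation plane R := (R * R)%type.
Notation space R := (R * R * R)%type.

Section Geometry.
Context {R : realType}.

Definition area (A : set (plane R)) : \bar R :=
  (@lebesgue_measure R \x @lebesgue_measure R)%E A.

Definition volume (A : set (space R)) : \bar R :=
  ((@lebesgue_measure R \x @lebesgue_measure R) \x @lebesgue_measure R)%E A.

Definition convex_hull (A : set (space R)) : set (space R) :=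
  smallest (@convex_set R (space R)) A.

Definition boundary (A : set (space R)) : set (space R) :=
  closure A `\` interior A.

Definition at_ground (F : set (plane R)) : set (space R) := F `*` [set 0].

Definition mountain (F : set (plane R)) (z : space R) : set (space R) :=
  convex_hull (at_ground F `|` [set z]).

Definition in_convex_position_above (F : set (plane R)) (n : nat)
    (x : 'I_n -> space R) : Prop :=
  forall i, boundary (convex_hull (range x `|` at_ground F)) (x i).

End Geometry.

Section RandomPoints.
Context {R : realType} {d : measure_display} {T : measurableType d}
  (P : probability T R).
Local Open Scope ereal_scope.

Definition uniform_in (K : set (space R)) (X : {RV P >-> space R}) : Prop :=
  forall A, measurable A ->
    distribution P X A = volume (A `&` K) / volume K.

Definition mutually_independent (n : nat) (X : 'I_n -> {RV P >-> space R}) :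
    Prop :=
  forall (J : {set 'I_n}) (A : 'I_n -> set (space R)),
    (forall i, measurable (A i)) ->
    P (\bigcap_(i in [set` J]) X i @^-1` A i)
    = \prod_(i in J) P (X i @^-1` A i).

(* [Q_K(n)], computed from [n] independent uniform points in the convex set
   whose floor is [F]. *)
Definition Qprob (F : set (plane R)) (n : nat)
    (U : 'I_n -> {RV P >-> space R}) : \bar R :=
  P [set w | in_convex_position_above F (fun i => U i w)].

End RandomPoints.

Definition Y (R : realType) (n : nat) : R :=
  2 ^+ n / n`!%:R * \prod_(1 <= j < n.+1) (3 * j%:R - 1)^-1.

(* Main.v *)
Require Import Defs.
From HB Require Import structures.
From mathcomp Require Import perm ring lra measurable_realfun.

(* Fix a point [o] of the floor. In the coordinates r = relative distance to the
   segment from [o] to the apex (measured by the gauge of [F] at [o]) and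
   t = height, a uniform point of the mountain has density 2r dr dt on the
   triangle r + t/3 < 1. If the points, in some order, have (r, t)-coordinates
   that climb from (1, 0) along a concave chain, then each of them is supported
   by a convex set {t + m r <= c}, hence they are in convex position above [F].
   Integrating over the first point of the chain, for which the others must fall
   in the smaller triangle under the prolonged edge, shows that a given order has
   probability Y_n / n!; the n! orders exclude each other since the heights
   increase along the chain. *)

Set Implicit Arguments.
Unset Strict Implicit.
Unset Printing Implicit Defensive.

Local Open Scope classical_set_scope.
Local Open Scope ring_scope.

(** * Measurability of sets open for finitely many functions *)

(** The shape of [F] disappears because the copy of [F] scaled by s about [o] has area s^2 for every
    [F]: the distance coordinate has law [beta_prob 2 1], with density 2 r. Convexity of [F] makes t
    + m r a convex function in space. The recursion closes because the region under a prolonged edge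
    is again a triangle with a side on r = 0: a chain leaving (rho, b) with slope below c stays in a
    triangle of mass c rho^3 / 3, and m points form such a chain with probability Y_m / m! times the
    m-th power of that mass. Only an inequality results, since points in convex position need not
    form a chain. The technical obstacle is that monotonicity of [P] is applied to measurable
    events, so convex position itself must be measurable. The hull has no explicit formula in its
    points; instead, lying in its interior is shown to survive small moves of all points, which
    makes that event open in finitely many coordinates. *)

Section Measurability.
Context {R : realType} {d : measure_display} {T : measurableType d}.

(* Rational boxes show that a set is measurable as soon as it is open for the
   topology induced by finitely many measurable functions. *)
Lemma measurable_open_wrt (I : finType) (X : I -> T -> R) (S : set T) :
  (forall i, measurable_fun setT (X i)) ->
  (forall w, S w -> exists2 e : R, 0 < e &
     forall w', (forall i, `|X i w' - X i w| < e) -> S w') ->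
  measurable S.
Proof.
move=> mX oS.
pose box (a : {ffun I -> rat} * nat) : set T :=
  \bigcap_(i in [set` [set: I]%SET]) X i @^-1` ball (ratr (a.1 i) : R) (a.2.+1%:R^-1).
have mbox a : measurable (box a).
  apply: fin_bigcap_measurable; first exact: finite_finset.
  by move=> i _; rewrite -[X in measurable X]setTI; apply: mX => //;
    exact: measurable_ball.
have -> : S = \bigcup_(a in [set a | box a `<=` S]) box a.
  apply/seteqP; split=> [w Sw|w [a aS aw]]; last exact: aS.
  have [e e0 eS] := oS _ Sw.
  have [k ke] : exists k : nat, (k.+1%:R^-1 : R) < e / 2.
    exists (Num.bound (e / 2)^-1); rewrite invf_plt ?posrE ?divr_gt0//.
    apply: (lt_le_trans (archi_boundP _)); first by rewrite invr_ge0; lra.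
    by rewrite ler_nat.
  have /choice[q qX] : forall i, exists q : rat, `|ratr q - X i w| < k.+1%:R^-1 :> R.
    move=> i; have [|q] := @rat_in_itvoo R (X i w - k.+1%:R^-1) (X i w).
      by rewrite ltrBlDr ltrDl invr_gt0.
    rewrite in_itv/= => /andP[q1 q2]; exists q.
    by rewrite ltr0_norm ?subr_lt0// opprB ltrBlDl -ltrBlDr.
  exists ([ffun i => q i], k).
    move=> w' /= bw'; apply: eS => i.
    have := bw' i; rewrite /= inE /ball/= ffunE => /(_ isT) h.
    rewrite (le_lt_trans (ler_distD (ratr (q i)) _ _))//.
    rewrite [ltRHS](splitr e); apply: ltrD.
      by rewrite distrC (lt_trans h).
    exact: (lt_trans (qX i)).
  by move=> i _ /=; rewrite /ball/= ffunE.
rewrite bigcup_mkcond; apply: countable_bigcupT_measurable => // a.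
by case: ifP.
Qed.

End Measurability.

Section Convex.
Context {R : realType} {V : lmodType R}.

Lemma convex_setP (A : set V) :
  convex_set A <->
  forall x y (l : R), 0 <= l -> l <= 1 -> A x -> A y -> A (l *: x + (1 - l) *: y).
Proof.
split=> [cA x y l l0 l1 Ax Ay|cA x y l /[!inE] Ax Ay].
  by have := cA x y (Itv01 l0 l1); rewrite !inE; exact.
exact: cA.
Qed.

End Convex.

(** * Convex hulls in space *)

Section ConvexHull.
Context {R : realType}.
Implicit Types (A B C : set (space R)) (p : space R).

Lemma sub_convex_hull A : A `<=` convex_hull A.
Proof. exact: sub_gen_smallest. Qed.

Lemma convex_hull_sub A B : convex_set B -> A `<=` B -> convex_hull A `<=` B.
Proof. exact: smallest_sub. Qed.

Lemma convex_hull_convex A : convex_set (convex_hull A).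
Proof.
apply/convex_setP => x y l l0 l1 Ax Ay B [cB AB].
by move/convex_setP : (cB); apply=> //; [exact: Ax | exact: Ay].
Qed.

(** Written as the image of a product with a segment, so that compactness passes through a
    continuous map. *)
Definition cone p A : set (space R) :=
  (fun u : R * space R => u.1 *: p + (1 - u.1) *: u.2) @` (`[0, 1] `*` A).

Lemma mem_cone p A (l : R) a : 0 <= l <= 1 -> A a -> cone p A (l *: p + (1 - l) *: a).
Proof. by move=> l01 Aa; exists (l, a) => //; split => //=; rewrite in_itv. Qed.

Lemma cone_convex p A : convex_set A -> convex_set (cone p A).
Proof.
move=> /convex_setP cA; apply/convex_setP => x y k k0 k1.
move=> [[l a] /= [/[!in_itv]/= /andP[l0 l1] Aa] <-].
move=> [[m b] /= [/[!in_itv]/= /andP[m0 m1] Ab] <-].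
pose q := k * l + (1 - k) * m.
have q1 : 1 - q = k * (1 - l) + (1 - k) * (1 - m) by rewrite /q; ring.
have [u0 v0] : 0 <= k * (1 - l) /\ 0 <= (1 - k) * (1 - m).
  by split; apply: mulr_ge0; rewrite ?subr_ge0.
have mix c e : q *: p + (1 - q) *: (c *: a + e *: b) =
    q *: p + ((1 - q) * c *: a + (1 - q) * e *: b).
  by rewrite scalerDr !scalerA.
have -> : k *: (l *: p + (1 - l) *: a) + (1 - k) *: (m *: p + (1 - m) *: b) =
    q *: p + (k * (1 - l) *: a + (1 - k) * (1 - m) *: b).
  by rewrite !scalerDr !scalerA addrACA -scalerDl.
have qitv : 0 <= q <= 1.
  apply/andP; split; last by rewrite -subr_ge0 q1 addr_ge0.
  by rewrite addr_ge0// mulr_ge0// subr_ge0.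
(* The total weight of [p] is [q]; what remains is normalised by 1 - q to a convex combination of
   [a] and [b]. If 1 - q = 0 both remaining weights vanish and the point is [p]. *)
have [q1E|q1N] := eqVneq (1 - q) 0.
  have [-> ->] : k * (1 - l) = 0 /\ (1 - k) * (1 - m) = 0.
    by move: u0 v0 q1; rewrite q1E => *; split; apply/eqP; rewrite eq_le; lra.
  have := mem_cone p qitv Aa.
  by rewrite q1E !scale0r !addr0.
pose c := k * (1 - l) / (1 - q).
have q0 : 0 < 1 - q by rewrite lt0r q1N q1 addr_ge0.
have -> : k * (1 - l) = (1 - q) * c by rewrite [RHS]mulrC divfK.
have -> : (1 - k) * (1 - m) = (1 - q) * (1 - c).
  by rewrite [RHS]mulrBr mulr1 [X in _ = _ - X]mulrC divfK// {1}q1; ring.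
rewrite -mix; apply: mem_cone => //; apply: cA => //; rewrite /c.
  by rewrite divr_ge0// ltW.
by rewrite ler_pdivrMr// mul1r q1 lerDl.
Qed.

Lemma cone_compact p A : compact A -> compact (cone p A).
Proof.
move=> cA; apply: continuous_compact; last first.
  by apply: compact_setX => //; exact: segment_compact.
apply: continuous_subspaceT => u.
apply: cvgD; apply: cvgZ; first exact: cvg_fst.
- exact: cvg_cst.
- by apply: cvgB; [exact: cvg_cst|exact: cvg_fst].
- exact: cvg_snd.
Qed.

Lemma convex_hull_coneE p A : A !=set0 ->
  convex_hull (p |` A) = cone p (convex_hull A).
Proof.
move=> [a Aa]; apply/seteqP; split.
  apply: convex_hull_sub; first exact/cone_convex/convex_hull_convex.
  move=> x [->|Ax].
    have := @mem_cone p (convex_hull A) 1 a.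
    by rewrite subrr scale0r addr0 scale1r; apply;
      [rewrite lexx ler01|exact: sub_convex_hull].
  have := @mem_cone p (convex_hull A) 0 x.
  by rewrite subr0 scale0r add0r scale1r; apply;
    [rewrite lexx ler01|exact: sub_convex_hull].
move=> _ [[l b] /= [/[!in_itv]/= /andP[l0 l1] Ab] <-].
have /convex_setP := @convex_hull_convex (p |` A); apply=> //.
  by apply: sub_convex_hull; left.
apply: convex_hull_sub Ab; first exact: convex_hull_convex.
by move=> y Ay; apply: sub_convex_hull; right.
Qed.

(** Adjoining one point turns the hull into a cone over the previous hull, and cones preserve
    compactness; this induction replaces Caratheodory's theorem. *)
Lemma convex_hull_compact (s : seq (space R)) A :
  compact A -> convex_set A -> A !=set0 -> compact (convex_hull ([set` s] `|` A)).
Proof.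
move=> cA vA A0; elim: s => [|p s IH].
  rewrite (_ : [set` [::]] = set0) ?set0U; last by apply/seteqP; split.
  rewrite (_ : convex_hull A = A)//.
  by apply/seteqP; split; [exact: convex_hull_sub|exact: sub_convex_hull].
have -> : [set` p :: s] = p |` [set` s].
  by apply/seteqP; split=> x /=; rewrite inE; [case/orP=> [/eqP->|]; [left|right]
    | case=> [->|->]; rewrite ?eqxx ?orbT].
rewrite -setUA convex_hull_coneE; first exact: cone_compact.
by case: A0 => a Aa; exists a; right.
Qed.

(* Iterating [b + e = c + e'] with [c] in [C] shows that [b] is at distance
   [O(1/m)] from the average of [m] points of [C]. *)
Lemma convex_cancel C (b : space R) (r : R) :
  closed C -> convex_set C ->
  (forall e, `|e| <= r -> exists2 c, C c & `|b + e - c| <= r) -> 0 <= r -> C b.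
Proof.
move=> clC /convex_setP vC bC r0.
have /choice[f fP] : forall e, exists c, `|e| <= r -> C c /\ `|b + e - c| <= r.
  move=> e; have [er|] := leP `|e| r; last by exists 0.
  by have [c Cc ce] := bC _ er; exists c.
pose e k := iter k (fun e => b + e - f e) 0.
have er k : `|e k| <= r.
  by elim: k => [|k IH]; [rewrite normr0|rewrite /= (fP _ IH).2].
(* This point is the average of [f (e 0)], ..., [f (e m)]: the sum of f (e k) = b + e k - e (k + 1)
   telescopes from [e 0] = 0. *)
have avg m : C (b - m.+1%:R^-1 *: e m.+1).
  elim: m => [|m IH].
    rewrite invr1 scale1r /= addr0 opprB addrCA subrr addr0.
    by apply: (fP 0 _).1; rewrite normr0.
  have -> : b - m.+2%:R^-1 *: e m.+2 = (m.+1%:R / m.+2%:R) *: (b - m.+1%:R^-1 *: e m.+1)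
      + (1 - m.+1%:R / m.+2%:R) *: f (e m.+1).
    set al := m.+1%:R / m.+2%:R; set be := m.+2%:R^-1.
    have al1 : 1 - al = be by rewrite /al /be; field; rewrite addrC -natr1.
    have albe : al * m.+1%:R^-1 = be.
      by rewrite /al mulrAC divff ?mul1r ?pnatr_eq0.
    rewrite al1 [in RHS]scalerBr scalerA albe (_ : e m.+2 = b + e m.+1 - f (e m.+1))//.
    have {1}-> : b = al *: b + be *: b by rewrite -scalerDl -al1 addrC subrK scale1r.
    rewrite scalerBr scalerDr opprB opprD [be *: f _ + _]addrC.
    by rewrite addrA addrA addrK.
  apply: vC => //; last exact: (fP _ (er _)).1.
  by rewrite ler_pdivrMr ?ltr0n// mul1r ler_nat.
have /closure_id -> := clC => B /nbhs_ballP[d /= d0 dB].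
pose m := Num.bound (r / d).
move: (avg m) (er m.+1); move: (e m.+1) => em avgm erm.
exists (b - m.+1%:R^-1 *: em); split; first exact: avgm.
apply: dB; rewrite -ball_normE /= opprB addrCA subrr addr0 normrZ.
rewrite ger0_norm ?invr_ge0// mulrC ltr_pdivrMr//.
rewrite (le_lt_trans erm)// mulrC -ltr_pdivrMr//.
rewrite (lt_trans (archi_boundP _))//; last by rewrite ltr_nat.
by rewrite divr_ge0// ltW.
Qed.

(* If a ball of radius [3 d] around [x i] lies in the hull and no point moves by
   more than [d], cancellation shows that a ball of radius [d] around the moved
   point lies in the new hull. *)
Lemma interior_convex_hull_stable (n : nat) (x : 'I_n -> space R) A i :
  compact A -> convex_set A -> A !=set0 ->
  interior (convex_hull (range x `|` A)) (x i) ->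
  exists2 e, 0 < e & forall y : 'I_n -> space R, (forall j, `|y j - x j| < e) ->
    interior (convex_hull (range y `|` A)) (y i).
Proof.
move=> cA vA A0 /nbhs_ballP[d /= d0 dB]; exists (d / 3); first by rewrite divr_gt0.
move=> y yx; apply/nbhs_ballP; exists (d / 3) => /=; first by rewrite divr_gt0.
move=> b yb.
have rangeE : range y = [set` codom y].
  apply/seteqP; split=> [_ [j _ <-]|_ /= /codomP[j ->]]; last by exists j.
  exact: codom_f.
apply: (@convex_cancel _ b (d / 3)); last by rewrite divr_ge0// ltW.
- apply: compact_closed; first exact: norm_hausdorff.
  by rewrite rangeE; exact: convex_hull_compact.
- exact: convex_hull_convex.
(* The closeness set around the new hull is convex and contains every old generator, hence the old
   hull; this supplies the point near [b + e] that [convex_cancel] asks for. *)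
move=> e ed; pose near_hull : set (space R) :=
  [set c | exists2 c', convex_hull (range y `|` A) c' & `|c - c'| <= d / 3].
have : convex_hull (range x `|` A) (b + e).
  apply: dB; rewrite -ball_normE /= in yb *.
  have -> : x i - (b + e) = (x i - y i) + (y i - b) - e.
    by rewrite opprD addrA subrKA.
  rewrite (le_lt_trans (ler_normB _ _))// (le_lt_trans (lerD (ler_normD _ _) ed))//.
  by have := yx i; rewrite distrC; lra.
suff /convex_hull_sub : convex_set near_hull.
  move=> /[apply]; apply=> c [[j _ <-]|Ac].
    exists (y j); last by rewrite distrC ltW.
    by apply: sub_convex_hull; left; exists j.
  exists c; last by rewrite subrr normr0 divr_ge0// ltW.
  by apply: sub_convex_hull; right.
apply/convex_setP => u v l l0 l1 [u' hu uu'] [v' hv vv'].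
exists (l *: u' + (1 - l) *: v').
  by have /convex_setP := @convex_hull_convex (range y `|` A); apply.
rewrite opprD addrACA -!scalerBr (le_trans (ler_normD _ _))// !normrZ.
rewrite !ger0_norm ?subr_ge0//.
have := ler_wpM2l l0 uu'; have := ler_wpM2l (_ : 0 <= 1 - l) vv'.
by rewrite subr_ge0 => /(_ l1); lra.
Qed.

End ConvexHull.

(** * Lebesgue measure under affine maps *)

(* The instance depends on [mf], hence cannot be inferred from [pushforward m f]. *)
Definition pushforward_measure d1 d2 (T1 : measurableType d1)
  (T2 : measurableType d2) (R : realType) (m : {measure set T1 -> \bar R})
  (f : T1 -> T2) (mf : measurable_fun setT f) : {measure set T2 -> \bar R} :=
  measure_function_pushforward__canonical__measure_function_Measure m mf.

(** The product measure is defined by integrating over the first factor. Agreement on rectangles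
    gives the other order, needed because horizontal slices fix the last coordinate. *)
Lemma product_measure12E d1 d2 (T1 : measurableType d1) (T2 : measurableType d2)
    (R : realType) (m1 : {sigma_finite_measure set T1 -> \bar R})
    (m2 : {sigma_finite_measure set T2 -> \bar R}) (A : set (T1 * T2)) :
  measurable A -> (m1 \x m2)%E A = (\int[m2]_y m1 (ysection A y))%E.
Proof.
move=> mA; apply: (product_measure_unique
  (m' := lebesgue_integral_fubini_product_measure2__canonical__measure_function_Measure m1 m2)) => //.
by move=> B C mB mC; exact: product_measure2E.
Qed.

Section LebesgueAffine.
Context {R : realType}.
Local Notation lambda := (@lebesgue_measure R).
Local Open Scope ereal_scope.

Lemma measurable_affine (a c : R) :
  measurable_fun setT (fun x : measurableTypeR R => (a * x + c)%R : measurableTypeR R).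
Proof. by apply: measurable_funD => //; apply: measurable_funM. Qed.

(** The pushforward multiplied by [a] gives half-open intervals their length, so it is Lebesgue
    measure by uniqueness. *)
Lemma lebesgue_measure_affine (a c : R) A : (0 < a)%R -> measurable A ->
  lambda ((fun x => (a * x + c)%R) @^-1` A) = (a^-1)%:E * lambda A.
Proof.
move=> a0 mA; have na : (0 <= a)%R by exact: ltW.
pose m := mscale (NngNum na) (pushforward_measure lambda (measurable_affine a c)).
rewrite [in RHS](@lebesgue_measure_unique R m)//.
  rewrite /m/= /mscale/= muleA -EFinM mulVf ?gt_eqF// mul1e.
  by [].
move=> _ [[x y] _ <-].
rewrite /m/= /mscale/= /pushforward.
have -> : (fun x => (a * x + c)%R) @^-1` `]x, y]%classic =
    `]((x - c) / a)%R, ((y - c) / a)%R]%classic.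
  apply/seteqP; split=> u /=; rewrite !in_itv/= ltr_pdivrMr// ler_pdivlMr//;
  by rewrite ltrBlDr lerBrDr mulrC.
rewrite !lebesgue_measure_itv/= !lte_fin ltr_pM2r ?invr_gt0// ltrD2r.
case: ifP => _; last by rewrite mule0.
by rewrite -!EFinD -EFinM; congr (_%:E); field; rewrite gt_eqF.
Qed.

Lemma measurable_affine2 (a c e : R) : measurable_fun setT
  (fun p : plane (measurableTypeR R) =>
    (a * p.1 + c, a * p.2 + e)%R : plane (measurableTypeR R)).
Proof.
apply: measurable_fun_pair; apply: measurable_funD => //; apply: measurable_funM => //.
Qed.

Lemma area_affine (a c e : R) (A : set (plane R)) : (0 < a)%R -> measurable A ->
  area ((fun p => (a * p.1 + c, a * p.2 + e)%R) @^-1` A) = (a ^- 2)%:E * area A.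
Proof.
move=> a0 mA; have na : (0 <= a ^+ 2)%R by exact: sqr_ge0.
pose m := mscale (NngNum na)
  (pushforward_measure (lambda \x lambda) (measurable_affine2 a c e)).
have key (x y : \bar R) : (a ^+ 2)%:E * (((a^-1)%:E * x) * ((a^-1)%:E * y)) = x * y.
  rewrite muleACA -EFinM [LHS]muleA -EFinM (_ : _ * _ = 1)%R ?mul1e//.
  by field; rewrite gt_eqF.
rewrite /area [in RHS](@product_measure_unique _ _ _ _ _ lambda lambda m)//.
  by rewrite /m/= /mscale/= muleA -EFinM mulVf ?mul1e// expf_neq0 ?gt_eqF.
move=> B C mB mC.
rewrite /m/= /mscale/= /pushforward.
have -> : (fun p => (a * p.1 + c, a * p.2 + e)%R) @^-1` (B `*` C) =
  ((fun x => (a * x + c)%R) @^-1` B) `*` ((fun x => (a * x + e)%R) @^-1` C) by [].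
rewrite product_measure1E//; last 2 first.
- by rewrite -[X in measurable X]setTI; exact: measurable_affine.
- by rewrite -[X in measurable X]setTI; exact: measurable_affine.
transitivity ((a ^+ 2)%:E * (((a^-1)%:E * lambda B) * ((a^-1)%:E * lambda C))).
  by congr (_ * (_ * _)); exact: lebesgue_measure_affine.
exact: key.
Qed.

(* Inference finds sigma-finiteness of [_ \x _] only for subprobabilities. *)
Definition plane_measure : set (plane (measurableTypeR R)) -> \bar R :=
  lambda \x lambda.

HB.instance Definition _ := Measure.on plane_measure.

Let plane_measure_sigma_finite : sigma_finite setT plane_measure.
Proof.
have /sigma_finiteP[F [TF ndF Foo]] := sigma_finiteT lambda.
exists (fun n => F n `*` F n).
  rewrite -setXTT {1 2}TF predeqE => -[x y]; split.
    move=> [/= [n _ Fnx] [k _ Fky]]; exists (maxn n k) => //; split.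
    - by move: x Fnx; exact/subsetPset/ndF/leq_maxl.
    - by move: y Fky; exact/subsetPset/ndF/leq_maxr.
  by move=> [n _ []/= ? ?]; split; exists n.
move=> k; have [mF Fk] := Foo k; split; first exact: measurableX.
by rewrite /plane_measure product_measure1E// lte_mul_pinfty// ge0_fin_numE.
Qed.

HB.instance Definition _ :=
  Measure_isSigmaFinite.Build _ _ _ plane_measure plane_measure_sigma_finite.

Lemma volume_slices (A : set (space R)) : measurable A ->
  volume A = \int[lambda]_t area (ysection A t).
Proof.
exact: (@product_measure12E _ _ _ _ R plane_measure lambda A).
Qed.

End LebesgueAffine.

(** * Integrals of polynomials *)

Section PolynomialIntegrals.
Context {R : realType}.
Local Notation lambda := (@lebesgue_measure R).

Lemma continuous_poly (p : {poly R}) : continuous (horner p).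
Proof. by move=> x; exact/differentiable_continuous/derivable1_diffP/derivable_horner. Qed.

Lemma measurable_poly (D : set R) (p : {poly R}) : measurable_fun D (horner p).
Proof.
apply: measurable_funTS; apply: continuous_measurable_fun; exact: continuous_poly.
Qed.

Lemma integral_poly (p q : {poly R}) (a b : R) : a <= b -> p^`() = q ->
  (\int[lambda]_(x in `[a, b]) (q.[x])%:E = (p.[b] - p.[a])%:E)%E.
Proof.
move=> + <-; rewrite le_eqVlt => /predU1P[->|ab].
  by rewrite set_itv1 integral_set1 subrr.
rewrite (@continuous_FTC2 _ _ (horner p))//.
- exact/continuous_subspaceT/continuous_poly.
- split; first by move=> x _; exact: derivable_horner.
    exact/cvg_at_right_filter/continuous_poly.
  exact/cvg_at_left_filter/continuous_poly.
- by move=> x _; rewrite -derivE.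
Qed.

(** The probability with density 2 r on [0, 1], which will be the law of the gauge of a uniform
    point of the floor. *)
Local Notation beta := (@beta_prob R 2 1).

Lemma beta_fun21 : beta_fun 2 1 = 2^-1 :> R.
Proof. by rewrite beta_fun_sym beta_fun1Sn. Qed.

Lemma beta_pdf21 (x : R) : 0 <= x <= 1 -> beta_pdf 2 1 x = x * 2.
Proof.
move=> x01; rewrite /beta_pdf patchE mem_set/= ?in_itv//.
by rewrite beta_fun21 invrK /XMonemX expr0 mulr1 expr1.
Qed.

Lemma integral_beta21_poly (p q : {poly R}) (s : R) : 0 <= s <= 1 ->
  p^`() = q * (2%:P * 'X) ->
  (\int[beta]_(x in `[0%R, s]) (q.[x])%:E = (p.[s] - p.[0])%:E)%E.
Proof.
move=> /andP[s0 s1] pq; rewrite integral_beta_prob//.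
- rewrite -(integral_poly s0 pq).
  apply: eq_integral => x; rewrite inE/= in_itv/= => /andP[x0 xs].
  rewrite beta_pdf21 ?x0 ?(le_trans xs)// -EFinM !hornerE; congr (_%:E).
  exact: mulrAC.
- by apply/measurable_EFinP; exact: measurable_poly.
(* Integrability: a polynomial is bounded on the segment and the measure has mass at most 1. *)
- have [M qM] : exists M, forall x, 0 <= x <= s -> `|q.[x]| <= M.
    have [|c _ cM] := @EVT_max R (fun x => `|q.[x]|) 0 s s0.
      apply: continuous_subspaceT => x.
      by apply: (@continuous_comp _ _ _ (horner q) (@Num.norm _ _));
        [exact: continuous_poly|exact: norm_continuous].
    by exists `|q.[c]| => x xs; apply: cM; rewrite in_itv.
  apply: (@le_lt_trans _ _ (\int[beta]_(x in `[0%R, s]) (cst M%:E x))%E).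
    apply: ge0_le_integral => //=.
    by apply/measurable_EFinP/measurableT_comp => //; exact: measurable_poly.
  rewrite integral_cst//.
  apply: (@le_lt_trans _ _ (M%:E * 1)%E).
    apply: lee_wpmul2l; last exact: probability_le1.
    by rewrite lee_fin (le_trans _ (qM 0 _))// lexx.
  by rewrite mule1 ltry.
Qed.

Lemma beta21_ray (s : R) : 0 <= s <= 1 -> beta `]-oo, s[%classic = (s ^+ 2)%:E.
Proof.
move=> /andP[s0 s1]; rewrite /beta_prob /mscale/= beta_fun21 invrK.
rewrite integral_XMonemX_restrict (_ : _ `&` _ = `[0, s[%classic); last first.
  apply/seteqP; split=> x /=; rewrite !in_itv/=; first by move=> [-> /andP[->]].
  by move=> /andP[-> xs]; rewrite xs (le_trans (ltW xs)).
rewrite integral_itv_bndo_bndc; last first.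
  by apply/measurable_EFinP; exact: measurable_XMonemX.
under eq_integral do rewrite XMonemXn0 expr1 -[X in X%:E]hornerX.
rewrite (@integral_poly (2^-1 *: 'X^2))//; last first.
  by rewrite derivZ derivXn -[X in _ *: X]scaler_nat scalerA mulVf ?pnatr_eq0// scale1r expr1.
rewrite !hornerZ !hornerXn expr0n/= mulr0 subr0 -EFinM mulrA divff ?mul1r//.
Qed.

End PolynomialIntegrals.

(** * Gauge of the floor *)

Section Coordinates.
Context {R : realType}.

(** A finite index type for the three coordinates is the format that [measurable_open_wrt] takes. *)
Definition space_coord (k : option bool) (u : space R) : R :=
  match k with Some true => u.1.1 | Some false => u.1.2 | None => u.2 end.

Lemma measurable_space_coord k : measurable_fun setT (space_coord k).
Proof.
by case: k => [[]|]; rewrite /space_coord; do ?[exact: measurable_fst|exact: measurable_snd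
  |exact: (measurableT_comp measurable_fst measurable_fst)
  |exact: (measurableT_comp measurable_snd measurable_fst)].
Qed.

Lemma norm_coord_lt (u v : space R) e :
  (forall k, `|space_coord k u - space_coord k v| < e) -> `|u - v| < e.
Proof.
move=> H; rewrite !prod_normE !gt_max /=.
by rewrite (H (Some true)) (H (Some false)) (H None).
Qed.

(** The sigma-algebra here is the product one, so closed sets are not measurable by definition: the
    complement is open with respect to the three coordinates. *)
Lemma closed_measurable_space (A : set (space R)) : closed A -> measurable A.
Proof.
move=> cA; rewrite -[A]setCK; apply: measurableC.
apply: (measurable_open_wrt measurable_space_coord) => u Au.
have /nbhs_ballP[e /= e0 eA] : nbhs u (~` A).
  by apply: open_nbhs_nbhs; split=> //; exact: closed_openC.
exists e => // v uv; apply: eA; rewrite -ball_normE /=.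
by rewrite distrC; exact: norm_coord_lt.
Qed.

Lemma closed_measurable_plane (A : set (plane R)) : closed A -> measurable A.
Proof.
move=> cA; rewrite -[A]setCK; apply: measurableC.
pose X (b : bool) (p : plane R) := if b then p.1 else p.2.
have mX b : measurable_fun setT (X b).
  by case: b; [exact: measurable_fst|exact: measurable_snd].
apply: (measurable_open_wrt mX) => u Au.
have /nbhs_ballP[e /= e0 eA] : nbhs u (~` A).
  by apply: open_nbhs_nbhs; split=> //; exact: closed_openC.
exists e => // v uv; apply: eA; rewrite -ball_normE /= distrC prod_normE gt_max.
by rewrite (uv true) (uv false).
Qed.

End Coordinates.

Section Gauge.
Context {R : realType}.
Variables (F : set (plane R)) (o : plane R).
Hypotheses (Fo : F o) (vF : convex_set F).

(** [F (dilate s q)] says that [q] lies in s (F - o); the infimum of such s is the Minkowski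
    functional of F - o. *)
Definition dilate (s : R) (q : plane R) : plane R :=
  (s^-1 * q.1 + o.1, s^-1 * q.2 + o.2).

(* The extra value [2] makes the gauge at least [1] away from [F]; on an empty
   set [inf] would be [0]. *)
Definition gauge (q : plane R) : R :=
  inf [set s | (0 < s /\ F (dilate s q)) \/ s = 2].

Let gauge_has_inf q : has_inf [set s | (0 < s /\ F (dilate s q)) \/ s = 2].
Proof. by split; [exists 2; right|exists 0 => s [[/ltW//]|->]]. Qed.

Lemma gauge_ge0 q : 0 <= gauge q.
Proof. by apply: lb_le_inf; [exists 2; right|move=> s [[/ltW//]|->]]. Qed.

Lemma gauge_le2 q : gauge q <= 2.
Proof. by apply: ge_inf; [exact: (gauge_has_inf q).2|right]. Qed.

Lemma gauge_le s q : 0 < s -> F (dilate s q) -> gauge q <= s.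
Proof. by move=> s0 Fs; apply: ge_inf; [exact: (gauge_has_inf q).2|left]. Qed.

(** The bound [s <= 2] rules out the artificial element 2 as the witness below [s]. *)
Lemma gauge_lt s q : gauge q < s -> s <= 2 ->
  exists2 s', 0 < s' < s & F (dilate s' q).
Proof.
move=> gs s2; have [x [[x0 Fx]|->] xs] := inf_lt (gauge_has_inf q).1 gs.
- by exists x; rewrite ?x0.
- by move: xs; rewrite ltNge s2.
Qed.

(** Convexity of the Minkowski functional, phrased on scales to avoid an infimum that may not be
    attained. *)
Lemma dilate_convex s r l (p q : plane R) : 0 < s -> 0 < r -> 0 <= l <= 1 ->
  F (dilate s p) -> F (dilate r q) ->
  F (dilate (l * s + (1 - l) * r)
       (l * p.1 + (1 - l) * q.1, l * p.2 + (1 - l) * q.2)).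
Proof.
move=> s0 r0 /andP[l0 l1] Fp Fq.
have t0 : 0 < l * s + (1 - l) * r.
  have [->|lN0] := eqVneq l 0; first by rewrite mul0r subr0 mul1r add0r.
  by apply: ltr_pwDl; [rewrite mulr_gt0// lt0r lN0|rewrite mulr_ge0 ?subr_ge0// ltW].
set t := _ + _ in t0 *.
have /convex_setP/(_ _ _ (l * s / t) _ _ Fp Fq) := vF.
have -> : dilate t (l * p.1 + (1 - l) * q.1, l * p.2 + (1 - l) * q.2) =
    (l * s / t) *: dilate s p + (1 - l * s / t) *: dilate r q.
  by congr (_, _); rewrite /= /GRing.scale/= /t; field; rewrite !gt_eqF.
apply; first by rewrite divr_ge0 ?mulr_ge0// ltW.
by rewrite ler_pdivrMr// mul1r lerDl mulr_ge0 ?subr_ge0// ltW.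
Qed.

(** [F] is star-shaped about its point [o], so the sets s (F - o) increase with s. *)
Lemma dilate_mono s r q : 0 < s -> s <= r -> F (dilate s q) -> F (dilate r q).
Proof.
move=> s0 sr Fs; have r0 := lt_le_trans s0 sr.
have /convex_setP/(_ _ _ (s / r) _ _ Fs Fo) := vF.
have -> : dilate r q = (s / r) *: dilate s q + (1 - s / r) *: o.
  by congr (_, _); rewrite /= /GRing.scale/=; field; rewrite !gt_eqF.
by apply; rewrite ?divr_ge0 ?ler_pdivrMr ?mul1r// ltW.
Qed.

End Gauge.

(** * Law of the gauge on the floor *)

Section GaugeLaw.
Context {R : realType}.
Variables (F : set (plane R)) (o : plane R).
Hypotheses (Fo : F o) (vF : convex_set F) (cF : compact F) (aF : area F = 1%E).
Local Notation beta := (@beta_prob R 2 1).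
Local Notation lambda := (@lebesgue_measure R).
Local Notation gauge := (gauge F o).

Lemma measurable_floor : measurable F.
Proof.
by apply: closed_measurable_plane; apply: compact_closed => //; exact: norm_hausdorff.
Qed.

Lemma dilateE s : dilate o s = fun p => (s^-1 * p.1 + o.1, s^-1 * p.2 + o.2).
Proof. by []. Qed.

Lemma measurable_dilate s : measurable (dilate o s @^-1` F).
Proof.
rewrite -[X in measurable X]setTI; apply: (measurable_affine2 s^-1 o.1 o.2) => //.
exact: measurable_floor.
Qed.

Lemma area_dilate s : 0 < s -> area (dilate o s @^-1` F) = (s ^+ 2)%:E.
Proof.
move=> s0; rewrite dilateE area_affine ?invr_gt0//; last exact: measurable_floor.
by rewrite aF mule1 exprVn invrK.
Qed.

Lemma gauge_ltE y : y <= 2 -> [set q | gauge q < y] =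
  \bigcup_(s : rat) (if 0 < (ratr s : R) < y then dilate o (ratr s : R) @^-1` F else set0).
Proof.
move=> y2; apply/seteqP; split=> [q /= /gauge_lt/(_ y2)[s /andP[s0 sy] Fs]|q [s _]].
  have [r] := rat_in_itvoo sy; rewrite in_itv/= => /andP[sr ry].
  exists r => //; rewrite (lt_trans s0 sr) ry/=.
  exact: (dilate_mono Fo vF s0 (ltW sr) Fs).
by case: ifP => // /andP[s0 sy] Fs; apply: le_lt_trans sy; exact: gauge_le.
Qed.

Lemma measurable_gauge_lt y : measurable [set q | gauge q < y].
Proof.
have [y2|y2] := leP y 2; last first.
  rewrite (_ : [set _ | _] = setT)//; apply/seteqP; split=> // q _ /=.
  exact: le_lt_trans (gauge_le2 _ _ _) y2.
rewrite gauge_ltE//; apply: bigcupT_measurable_rat => s.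
by case: ifP => // _; exact: measurable_dilate.
Qed.

Lemma measurable_gauge : measurable_fun setT gauge.
Proof.
apply: (measurability _ (RGenInftyO.measurableE R)) => _ [_ [y ->] <-].
rewrite setTI (_ : _ @^-1` _ = [set q | gauge q < y]); first exact: measurable_gauge_lt.
by apply/seteqP; split=> q /=; rewrite in_itv.
Qed.

(** The sublevel set is squeezed between r (F - o), for every r < s, and s (F - o). *)
Lemma area_gauge_lt s : 0 <= s <= 2 -> area [set q | gauge q < s] = (s ^+ 2)%:E.
Proof.
move=> /andP[+ s2]; rewrite le_eqVlt => /predU1P[<-|s0].
  rewrite expr0n (_ : [set _ | _] = set0); first exact: (measure0 (@plane_measure R)).
  by apply/seteqP; split=> // q /=; rewrite ltNge gauge_ge0.
have le_area (A B : set (plane R)) : measurable A -> measurable B -> A `<=` B ->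
    (area A <= area B)%E.
  by move=> mA mB AB; apply: (@le_measure _ _ _ (@plane_measure R)); rewrite ?inE.
have up : (area [set q | (gauge q < s)%R] <= (s ^+ 2)%:E)%E.
  rewrite -area_dilate//; apply: le_area; [exact: measurable_gauge_lt|exact: measurable_dilate|].
  move=> q /= /gauge_lt/(_ s2)[r /andP[r0 rs] Fr].
  exact: (dilate_mono Fo vF r0 (ltW rs) Fr).
have lo r : 0 < r < s -> ((r ^+ 2)%:E <= area [set q | (gauge q < s)%R])%E.
  move=> /andP[r0 rs]; rewrite -area_dilate//.
  apply: le_area; [exact: measurable_dilate|exact: measurable_gauge_lt|].
  by move=> q Fq /=; apply: le_lt_trans rs; exact: gauge_le.
have a0 : (0 <= area [set q | (gauge q < s)%R])%E by exact: (measure_ge0 (@plane_measure R)).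
move: (area _) a0 up lo => [x| |]//; rewrite !lee_fin => x0 xs lo.
congr (_%:E); apply/eqP; rewrite eq_le xs/= leNgt; apply/negP => xs'.
(* Then (s - e)^2 > s^2 - 4 s e = x, against the lower bound at radius s - e. *)
pose e := (s ^+ 2 - x) / (4 * s).
have e0 : 0 < e by rewrite divr_gt0 ?subr_gt0// mulr_gt0.
have es : e * (4 * s) = s ^+ 2 - x by rewrite divfK// gt_eqF// mulr_gt0.
have e4 : e < s by rewrite ltr_pdivrMr ?mulr_gt0//; nra.
have /lo : 0 < s - e < s by lra.
by rewrite lee_fin; nra.
Qed.

(** Both sides give a ray ending at x in [0, 1] the value x^2, and rays form a generating pi-system.
    Area is first restricted to gauge below 1: the cap at 2 would otherwise carry infinite mass. *)
Lemma gauge_law (A : set R) : measurable A -> A `<=` `]-oo, 1[%classic ->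
  area (gauge @^-1` A) = beta A.
Proof.
move=> mA A1.
pose m := @pushforward_measure _ _ _ (measurableTypeR R) _
  (mrestr (@plane_measure R) (measurable_gauge_lt 1)) _ measurable_gauge.
have -> : area (gauge @^-1` A) = m A.
  rewrite /m/= /pushforward /mrestr; congr area; rewrite setIidl// => q /A1.
  by rewrite /= in_itv.
refine (@measure_unique _ R (measurableTypeR R) (@RGenInftyO.G R)
  (fun n => `]-oo, n%:R[%classic) _ _ _ _ m beta _ _ A mA) => //.
- exact: RGenInftyO.measurableE.
- move=> _ _ [x ->] [y ->]; exists (Num.min x y).
  by apply/seteqP; split=> z /=; rewrite !in_itv/= lt_min => /andP.
- by move=> n; exists n%:R.
- by apply/seteqP; split=> // x _; exists (Num.bound `|x|) => //=; rewrite in_itv/=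
    (le_lt_trans (ler_norm x))// archi_boundP.
- move=> _ [x ->]; rewrite /m/= /pushforward /mrestr.
  have -> : gauge @^-1` `]-oo, x[ `&` [set q | gauge q < 1] =
      [set q | gauge q < Num.min x 1].
    by apply/seteqP; split=> q /=; rewrite in_itv/= lt_min => /andP.
  have [x1|x1] := leP x 1.
    have [x0|x0] := leP 0 x.
      by rewrite beta21_ray ?x0//; apply: area_gauge_lt; rewrite x0 (le_trans x1)// ler1n.
    transitivity (0 : \bar R)%E.
      rewrite (_ : [set _ | _] = set0); first exact: (measure0 (@plane_measure R)).
      apply/seteqP; split=> // q /= qx.
      by have := lt_trans qx x0; rewrite ltNge gauge_ge0.
    have h := @beta21_ray R 0; rewrite lexx ler01 expr0n/= in h.
    apply/esym/eqP; rewrite eq_le measure_ge0 andbT.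
    apply: (@le_trans _ _ (beta `]-oo, 0%R[%classic)); last by rewrite h.
    by apply: le_measure; rewrite ?inE//; apply: subset_itvl; rewrite bnd_simp ltW.
  transitivity (1 : \bar R)%E.
    by have := @area_gauge_lt 1; rewrite ler01 ler1n expr1n; exact.
  apply/esym/eqP; rewrite eq_le probability_le1//=.
  have h := @beta21_ray R 1; rewrite lexx ler01 expr1n in h.
  apply: (@le_trans _ _ (beta `]-oo, 1%R[%classic)); first by rewrite h.
  by apply: le_measure; rewrite ?inE//; apply: subset_itvl; rewrite bnd_simp ltW.
- move=> n; rewrite /m/= /pushforward /mrestr.
  have := @area_gauge_lt 1; rewrite ler01 ler1n expr1n => /(_ isT) h.
  apply: (@le_lt_trans _ _ 1%E); last exact: ltry.
  rewrite -h; apply: (@le_measure _ _ _ (@plane_measure R)); rewrite ?inE.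
  - apply: measurableI; last exact: measurable_gauge_lt.
    by rewrite -[X in measurable X]setTI; exact: measurable_gauge.
  - exact: measurable_gauge_lt.
  - exact: subIsetr.
Qed.

End GaugeLaw.

(** * Volume of the mountain and law of the chart *)

Section ChartLaw.
Context {R : realType}.
Variables (F : set (plane R)) (o : plane R) (z : space R).
Hypotheses (Fo : F o) (vF : convex_set F) (cF : compact F) (aF : area F = 1%E).
Hypothesis z3 : z.2 = 3.
Local Notation beta := (@beta_prob R 2 1).
Local Notation lambda := (@lebesgue_measure R).

(* The axis of the mountain is the segment from [o] to [z]; [chart u] is the
   pair (relative distance to the axis at the height of [u], height). *)
Definition off_axis (u : space R) : plane R :=
  (u.1.1 - (o.1 + u.2 / 3 * (z.1.1 - o.1)), u.1.2 - (o.2 + u.2 / 3 * (z.1.2 - o.2))).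

Definition chart (u : space R) : plane R := (gauge F o (off_axis u), u.2).

Lemma measurable_chart : measurable_fun setT chart.
Proof.
apply: measurable_fun_pair; last exact: measurable_snd.
apply: measurableT_comp; first exact: measurable_gauge.
have m11 := @measurable_space_coord R (Some true).
have m12 := @measurable_space_coord R (Some false).
have m2 := @measurable_space_coord R None.
rewrite /space_coord in m11 m12 m2.
by apply: measurable_fun_pair; apply: measurable_funB => //;
  apply: measurable_funD => //; apply: measurable_funM => //; apply: measurable_funM.
Qed.

Lemma at_ground_convex : convex_set (at_ground F).
Proof.
move/convex_setP : (vF) => vF'; apply/convex_setP => -[a a3] [b b3] l l0 l1 /= [/= Fa ->] [/= Fb ->].
by split; [exact: vF'|rewrite /= /GRing.scale/= !mulr0 addr0].
Qed.

Lemma at_ground_compact : compact (at_ground F).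
Proof. by apply: compact_setX => //; exact: compact_set1. Qed.

Lemma mountainE : mountain F z = cone z (at_ground F).
Proof.
rewrite /mountain setUC convex_hull_coneE; last by exists (o, 0).
congr cone; apply/seteqP; split; last exact: sub_convex_hull.
by apply: convex_hull_sub => //; exact: at_ground_convex.
Qed.

Lemma measurable_mountain : measurable (mountain F z).
Proof.
apply: closed_measurable_space; apply: compact_closed; first exact: norm_hausdorff.
by rewrite mountainE; apply: cone_compact; exact: at_ground_compact.
Qed.

(** The slice at this height is (1 - s) z + s F, and the point tested against [F] is the projection
    of [u] from the apex to the ground. *)
Lemma mem_mountain (s : R) (u : space R) : 0 < s <= 1 -> u.2 = 3 * (1 - s) ->
  mountain F z u <->
  F (s^-1 * u.1.1 - s^-1 * (1 - s) * z.1.1, s^-1 * u.1.2 - s^-1 * (1 - s) * z.1.2).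
Proof.
move=> /andP[s0 s1] us; rewrite mountainE; split.
  move=> [[l [a a3]] /= [/[!in_itv]/= /andP[l0 l1] [/= Fa a30]]] uE.
  have ls : l = 1 - s.
    move: us; rewrite -uE /= /GRing.scale/= a30 z3 mulr0 addr0 mulrC.
    by move/mulfI; apply; rewrite pnatr_eq0.
  suff -> : (s^-1 * u.1.1 - s^-1 * (1 - s) * z.1.1,
    s^-1 * u.1.2 - s^-1 * (1 - s) * z.1.2) = a by [].
  rewrite -uE /= /GRing.scale/= ls [RHS]surjective_pairing.
  by congr (_, _); field; rewrite gt_eqF.
set f := (X in F X) => Ff.
have := @mem_cone _ z (at_ground F) (1 - s) (f, 0).
have -> : (1 - s) *: z + (1 - (1 - s)) *: (f, 0) = u.
  rewrite [RHS]surjective_pairing [u.1]surjective_pairing us.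
  congr (_, _, _); rewrite /= /GRing.scale/= ?z3; last by ring.
  - by field; rewrite gt_eqF.
  - by field; rewrite gt_eqF.
by apply; [rewrite subr_ge0 s1 gerBl ltW|].
Qed.

Lemma mountain_height u : mountain F z u -> 0 <= u.2 <= 3.
Proof.
rewrite mountainE => -[[l [a a3]] /= [/[!in_itv]/= /andP[l0 l1] [/= Fa a30]]] <-.
by rewrite /= /GRing.scale/= a30 z3 mulr0 addr0; lra.
Qed.

Lemma mountain_top u : mountain F z u -> u.2 = 3 -> u = z.
Proof.
rewrite mountainE => -[[l [a a3]] /= [/[!in_itv]/= /andP[l0 l1] [/= Fa a30]]] <-.
move=> l3; have {l3} : l * z.2 + (1 - l) * a3 = 3 := l3.
rewrite a30 z3 mulr0 addr0 => l3; have -> : l = 1 by lra.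
by rewrite scale1r subrr scale0r addr0.
Qed.

Lemma chart_mountain u : 0 <= (chart u).2 -> (chart u).1 + (chart u).2 / 3 < 1 ->
  mountain F z u.
Proof.
rewrite /= => u0 gu; set s := 1 - u.2 / 3.
have g0 := gauge_ge0 F o (off_axis u).
have s01 : 0 < s <= 1 by rewrite /s; lra.
have us : u.2 = 3 * (1 - s) by rewrite /s; field.
have gs : gauge F o (off_axis u) < s by rewrite /s; lra.
have [|r /andP[r0 rs] Fr] := gauge_lt gs; first by move: s01; lra.
apply/(mem_mountain s01 us).
have := dilate_mono Fo vF r0 (ltW rs) Fr.
congr F; rewrite /dilate /off_axis/= us; move/andP: s01 => [s0 _].
by congr (_, _); field; rewrite gt_eqF.
Qed.

Lemma volume_mountain : volume (mountain F z) = 1%E.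
Proof.
rewrite volume_slices; last exact: measurable_mountain.
(* At height 3 the slice is a single point; there the scale is 0 and [mem_mountain] does not
   apply. *)
have slice0 t : ~ (0 <= t < 3) -> area (ysection (mountain F z) t) = 0%E.
  move=> tN; have [->|t3] := eqVneq t 3.
    have z0 : area ([set z.1.1] `*` [set z.1.2]) = 0%E.
      rewrite /area product_measure1E//.
      transitivity (0 * lambda [set z.1.2])%E; last exact: mul0e.
      by congr (_ * _)%E; exact: lebesgue_measure_set1.
    apply/eqP; rewrite eq_le; apply/andP; split; last exact: (measure_ge0 (@plane_measure R)).
    rewrite -z0.
    apply: (@le_measure _ _ _ (@plane_measure R)); rewrite ?inE.
    - by apply: measurable_ysection; exact: measurable_mountain.
    - exact: measurableX.
    - move=> p; rewrite /ysection/= inE => /mountain_top/(_ erefl) pz.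
      by split=> /=; rewrite -pz.
  rewrite (_ : ysection _ _ = set0); first exact: (measure0 (@plane_measure R)).
  apply/seteqP; split=> // p; rewrite /ysection/= inE => /mountain_height/=.
  by move=> /andP[t0 t3']; apply: tN; rewrite t0 lt_neqAle t3 t3'.
have slice t : 0 <= t < 3 -> area (ysection (mountain F z) t) = ((1 - t / 3) ^+ 2)%:E.
  move=> /andP[t0 t3]; set s := 1 - t / 3.
  have s01 : 0 < s <= 1 by rewrite /s; lra.
  have [s0 _] := andP s01.
  have := @area_affine R s^-1 (- (s^-1 * (1 - s) * z.1.1)) (- (s^-1 * (1 - s) * z.1.2)) F.
  rewrite aF mule1 exprVn invrK invr_gt0 => <-//; last exact: measurable_floor.
  congr area; apply/seteqP; split=> p; rewrite /ysection/= inE;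
    by move/(@mem_mountain s (p, t) s01); apply; rewrite /= /s; field.
transitivity (\int[lambda]_(t in `[0%R, 3%R[) ((1 - t / 3) ^+ 2)%:E)%E.
  rewrite [RHS]integral_mkcond; apply: eq_integral => t _; rewrite patchE.
  case: ifPn; rewrite ?inE ?notin_setE/= in_itv/=; first exact: slice.
  by move=> tN; rewrite slice0//; apply/negP.
pose p : {poly R} := (1 - 3^-1 *: 'X).
have pE t : (1 - t / 3) ^+ 2 = (p ^+ 2).[t].
  by rewrite /p !(hornerE, horner_exp) [t / 3]mulrC.
under eq_integral do rewrite pE.
rewrite integral_itv_bndo_bndc; last first.
  by apply/measurable_EFinP; exact: measurable_poly.
rewrite (@integral_poly _ (- (p ^+ 3)))//; last first.
  have dp : p^`() = - (3^-1)%:P.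
    by rewrite /p derivB -[1]polyC1 derivC sub0r derivZ derivX -alg_polyC.
  rewrite derivN deriv_exp dp mulNr mulNrn opprK -[LHS]mulr_natl mulrA.
  by rewrite -polyC_natr -polyCM divff ?mul1r ?pnatr_eq0.
by rewrite /p !(hornerE, horner_exp); congr (_%:E); field.
Qed.

(** Slice by height: off the axis point, each slice is a translate of a set described by the gauge.
    Inside the open triangle, membership in the mountain is automatic and the gauge is below 1,
    where its law is known. *)
Lemma chart_law (B : set (plane R)) : measurable B ->
  B `<=` [set x | 0 <= x.2 /\ x.1 + x.2 / 3 < 1] ->
  volume (chart @^-1` B `&` mountain F z) = (beta \x lambda)%E B.
Proof.
move=> mB BT; rewrite setIidl; last first.
  by move=> u Bu; have /= [] := BT _ Bu; exact: chart_mountain.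
rewrite volume_slices; last first.
  by rewrite -[X in measurable X]setTI; exact: measurable_chart.
rewrite product_measure12E//; apply: eq_integral => t _.
have mBt : measurable (ysection B t) by exact: measurable_ysection.
transitivity (area (gauge F o @^-1` ysection B t)); last first.
  apply: gauge_law => // r; rewrite /ysection/= inE in_itv/= => /BT/= [t0 ?]; lra.
have mG : measurable (gauge F o @^-1` ysection B t).
  by rewrite -[X in measurable X]setTI; exact: measurable_gauge.
have := @area_affine R 1 (- (o.1 + t / 3 * (z.1.1 - o.1)))
  (- (o.2 + t / 3 * (z.1.2 - o.2))) _ ltr01 mG.
rewrite expr1n invr1 mul1e => <-; congr area; apply/seteqP.
by split=> p; rewrite /ysection/= !inE/= /chart /off_axis/= !mul1r.
Qed.

End ChartLaw.

(** * Concave chains *)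

Section RealMeasurability.
Context {R : realType}.

Lemma measurable_inv : measurable_fun setT (fun x : R => x^-1).
Proof.
have -> : [set: R] = [set x | x != 0] `|` [set 0].
  by apply/seteqP; split=> // x _ /=; have [->|] := eqVneq x 0; [right|left].
have oN0 : open [set x : R | x != 0].
  rewrite (_ : [set _ | _] = ~` [set 0]); first exact/closed_openC/closed_eq.
  by apply/seteqP; split=> x /= /eqP.
apply/measurable_funU => //; first exact: open_measurable.
split; last exact: measurable_fun_set1.
apply: open_continuous_measurable_fun => // x; rewrite inE/= => x0.
exact: inv_continuous.
Qed.

Context {d : measure_display} {T : measurableType d}.
Implicit Types f g : T -> R.

Lemma measurable_lt f g : measurable_fun setT f -> measurable_fun setT g ->
  measurable [set w | f w < g w].
Proof.
move=> mf mg; rewrite (_ : [set _ | _] = (fun w => g w - f w) @^-1` `]0, +oo[).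
  by rewrite -[X in measurable X]setTI; apply: measurable_funB.
by apply/seteqP; split=> w /=; rewrite in_itv/= andbT subr_gt0.
Qed.

Lemma measurable_le f g : measurable_fun setT f -> measurable_fun setT g ->
  measurable [set w | f w <= g w].
Proof.
move=> mf mg; rewrite (_ : [set _ | _] = (fun w => g w - f w) @^-1` `[0, +oo[).
  by rewrite -[X in measurable X]setTI; apply: measurable_funB.
by apply/seteqP; split=> w /=; rewrite in_itv/= andbT subr_ge0.
Qed.

End RealMeasurability.

Section Chain.
Context {R : realType}.

(* [s] runs up a concave chain over the radial axis, from radius [rho] and height
   [b] towards the axis, the first segment being less steep than [c]. *)
Fixpoint chain (c rho b : R) (s : seq (plane R)) : bool :=
  if s is x :: s' then
    [&& 0 <= x.1, x.1 < rho, b < x.2, x.2 - b < c * (rho - x.1)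
      & chain ((x.2 - b) / (rho - x.1)) x.1 x.2 s']
  else true.

(** The parameters are functions of [w] because the recursive call reads them off the random first
    point. *)
Lemma measurable_chain d (T : measurableType d) m (W : T -> m.-tuple (plane R))
    (c rho b : T -> R) :
  measurable_fun setT c -> measurable_fun setT rho -> measurable_fun setT b ->
  measurable_fun setT W -> measurable [set w | chain (c w) (rho w) (b w) (W w)].
Proof.
elim: m W c rho b => [|m IH] W c rho b mc mr mb mW.
  by rewrite (_ : [set _ | _] = setT)//; apply/seteqP; split=> // w _ /=; rewrite tuple0.
pose x w := thead (W w).
have mx : measurable_fun setT x.
  exact: (measurableT_comp (measurable_tnth ord0) mW).
have mx1 : measurable_fun setT (fun w => (x w).1) by exact: measurableT_comp.
have mx2 : measurable_fun setT (fun w => (x w).2) by exact: measurableT_comp.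
have mL : measurable_fun setT (fun w => [tuple of behead (W w)]).
  exact: (measurableT_comp (@measurable_behead _ _ m) mW).
have -> : [set w | chain (c w) (rho w) (b w) (W w)] =
  [set w | 0 <= (x w).1] `&` [set w | (x w).1 < rho w] `&` [set w | b w < (x w).2] `&`
  [set w | (x w).2 - b w < c w * (rho w - (x w).1)] `&`
  [set w | chain (((x w).2 - b w) / (rho w - (x w).1)) (x w).1 (x w).2
    [tuple of behead (W w)]].
  have chainE w : chain (c w) (rho w) (b w) (W w) = [&& 0 <= (x w).1, (x w).1 < rho w,
      b w < (x w).2, (x w).2 - b w < c w * (rho w - (x w).1) &
      chain (((x w).2 - b w) / (rho w - (x w).1)) (x w).1 (x w).2
        [tuple of behead (W w)]] by rewrite {1}[W w]tuple_eta.
  apply/seteqP; split=> w /=; rewrite chainE.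
    by case/and5P => *; do !split.
  by move=> [[[[h1 h2] h3] h4] h5]; apply/and5P; split.
have mB : measurable_fun setT (fun w => rho w - (x w).1) by exact: measurable_funB.
have mN : measurable_fun setT (fun w => (x w).2 - b w) by exact: measurable_funB.
apply: measurableI; last first.
  apply: IH => //; apply: measurable_funM => //.
  exact: (measurableT_comp measurable_inv mB).
apply: measurableI; last by apply: measurable_lt => //; exact: measurable_funM.
apply: measurableI; last exact: measurable_lt.
apply: measurableI; last exact: measurable_lt.
exact: measurable_le.
Qed.

End Chain.

(** * Boxes as a generating pi-system for tuples *)

Section Boxes.
Context {d : measure_display} {T : measurableType d} (m : nat).

Definition box (B : 'I_m -> set T) : set (m.-tuple T) := [set y | forall i, B i (tnth y i)].

Definition boxes : set (set (m.-tuple T)) :=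
  [set box B | B in [set B | forall i, measurable (B i)]].

Lemma measurable_box B : (forall i, measurable (B i)) -> measurable (box B).
Proof.
move=> mB; rewrite (_ : box B = \bigcap_(i in [set` [set: 'I_m]%SET]) (@tnth _ T ^~ i @^-1` B i)).
  apply: fin_bigcap_measurable; first exact: finite_finset.
  by move=> i _; rewrite -[X in measurable X]setTI; exact: measurable_tnth.
by apply/seteqP; split=> [y yB i _|y yB i]; [exact: yB|apply: yB; rewrite /= inE].
Qed.

Lemma measurable_tupleE : @measurable _ (m.-tuple T) = <<s boxes >>.
Proof.
apply/seteqP; split; last first.
  apply: smallest_sub; first exact: sigma_algebra_measurable.
  by move=> _ [B mB <-]; exact: measurable_box.
apply: smallest_sub; first exact: smallest_sigma_algebra.
rewrite -bigcup_seq; apply: bigcup_sub => i _ _ [A mA <-].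
apply: sub_sigma_algebra; exists (fun j => if j == i then A else setT).
  by move=> j /=; case: ifP.
apply/seteqP; split=> y /=; last by move=> [_ Ay] j; case: eqP => // ->.
by move=> /(_ i); rewrite eqxx.
Qed.

Lemma boxesI : setI_closed boxes.
Proof.
move=> _ _ [B mB <-] [C mC <-]; exists (fun i => B i `&` C i).
  by move=> i; exact: measurableI.
by apply/seteqP; split=> y /=; [move=> H; split=> i; case: (H i)|move=> [? ?] i; split].
Qed.

End Boxes.

(** * Independent tuples *)

Section TupleTail.
Context {d d' : measure_display} {T : measurableType d} {A : measurableType d'} {m : nat}.
Variable W : {mfun T >-> m.+1.-tuple A}.

Definition tuple_head (w : T) : A := thead (W w).
Definition tuple_tail (w : T) : m.-tuple A := [tuple of behead (W w)].

Lemma measurable_tuple_head : measurable_fun setT tuple_head.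
Proof. exact: (measurableT_comp (measurable_tnth ord0)). Qed.

Lemma measurable_tuple_tail : measurable_fun setT tuple_tail.
Proof. exact: (measurableT_comp (@measurable_behead _ _ m)). Qed.

HB.instance Definition _ := isMeasurableFun.Build _ _ _ _ tuple_tail measurable_tuple_tail.

End TupleTail.

Section IndependentTuples.
Context {R : realType} {d' : measure_display} {A : measurableType d'}.
Variable nu : probability A R.
Context {d : measure_display} {T : measurableType d} (P : probability T R).
Local Open Scope ereal_scope.

Definition iid_tuple m (W : {mfun T >-> m.-tuple A}) : Prop :=
  forall B : 'I_m -> set A, (forall i, measurable (B i)) ->
    P (W @^-1` box B) = \prod_(i < m) nu (B i).

Lemma preimage_box_cons m (W : {mfun T >-> m.+1.-tuple A}) C (B : 'I_m -> set A) :
  tuple_head W @^-1` C `&` tuple_tail W @^-1` box B =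
  W @^-1` box (fun i => if unlift ord0 i is Some j then B j else C).
Proof.
apply/seteqP; split=> w /=.
  move=> [Cw Bw] i; case: unliftP => [j ->|->]; last by [].
  by have := Bw j; rewrite /tuple_tail/= (tnth_nth (thead (W w))) nth_behead
    (tnth_nth (thead (W w))).
move=> H; split; first by have := H ord0; rewrite unlift_none.
move=> j; have := H (lift ord0 j); rewrite liftK.
by rewrite /tuple_tail/= [in X in _ -> X](tnth_nth (thead (W w))) nth_behead
  (tnth_nth (thead (W w))).
Qed.

Lemma iid_cons m (W : {mfun T >-> m.+1.-tuple A}) C (B : 'I_m -> set A) :
  iid_tuple W -> measurable C -> (forall i, measurable (B i)) ->
  P (tuple_head W @^-1` C `&` tuple_tail W @^-1` box B) = nu C * \prod_(i < m) nu (B i).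
Proof.
move=> iW mC mB; rewrite preimage_box_cons iW; last by move=> i; case: unliftP.
rewrite big_ord_recl unlift_none; congr (_ * _).
by apply: eq_bigr => i _; rewrite liftK.
Qed.

Lemma iid_tail m (W : {mfun T >-> m.+1.-tuple A}) : iid_tuple W -> iid_tuple (tuple_tail W).
Proof.
move=> iW B mB; have := iid_cons iW (@measurableT _ A) mB.
by rewrite preimage_setT setTI probability_setT mul1e.
Qed.

(** For fixed [C] both sides are finite measures in [D] that agree on boxes, where [iid_tuple]
    speaks; uniqueness extends this to all [D]. *)
Lemma head_tail_indep m (W : {mfun T >-> m.+1.-tuple A}) C D :
  iid_tuple W -> measurable C -> measurable D ->
  P (tuple_head W @^-1` C `&` tuple_tail W @^-1` D) =
  nu C * distribution P (tuple_tail W) D.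
Proof.
move=> iW mC mD.
have mHC : measurable (tuple_head W @^-1` C).
  by rewrite -[X in measurable X]setTI; exact: measurable_tuple_head.
pose m1 := pushforward_measure (mrestr P mHC) (measurable_tuple_tail W).
have nuC0 : (0 <= fine (nu C))%R by rewrite fine_ge0.
pose m2 := mscale (NngNum nuC0) (distribution P (tuple_tail W)).
have nuCE : (fine (nu C))%:E = nu C by rewrite fineK// fin_num_measure.
transitivity (m1 D); first by rewrite /m1/= /pushforward /mrestr setIC.
transitivity (m2 D); last by rewrite /m2/= /mscale/= nuCE.
apply: (@measure_unique _ R (m.-tuple A) (@boxes _ A m) (fun=> setT) _ _ _ _ m1 m2) => //.
- exact: measurable_tupleE.
- exact: boxesI.
- move=> _; exists (fun=> setT) => //.
  by apply/seteqP; split=> y.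
- by rewrite bigcup_const.
- move=> _ [B mB <-]; rewrite /m1 /m2/= /pushforward /mrestr /mscale/= nuCE setIC iid_cons//.
  by rewrite /distribution /pushforward (iid_tail iW).
- move=> _; apply: (@le_lt_trans _ _ (P setT)); last by rewrite probability_setT ltry.
  by rewrite /m1/= /pushforward /mrestr; apply: le_measure; rewrite ?inE//;
    rewrite preimage_setT setTI.
Qed.

Lemma head_tail_law m (W : {mfun T >-> m.+1.-tuple A}) E : iid_tuple W -> measurable E ->
  P ((fun w => (tuple_head W w, tuple_tail W w)) @^-1` E) =
  (nu \x distribution P (tuple_tail W)) E.
Proof.
move=> iW mE.
have mp : measurable_fun setT (fun w => (tuple_head W w, tuple_tail W w)).
  by apply: measurable_fun_pair; [exact: measurable_tuple_head|exact: measurable_tuple_tail].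
apply/esym/(@product_measure_unique _ _ _ _ R nu (distribution P (tuple_tail W))
  (pushforward_measure P mp)) => // C D mC mD.
by rewrite -head_tail_indep.
Qed.

End IndependentTuples.

(** * Probability of a concave chain *)

Section ChainIntegral.
Context {R : realType}.
Local Notation beta := (@beta_prob R 2 1).
Local Notation lambda := (@lebesgue_measure R).

(** The last factor is what integrating out the first point yields: 1 / (m + 1) from the heights and
    2 / ((3 m + 2) (3 m + 3)) from the radii, with one 3 left to the power of c rho^3 / 3. *)
Lemma Y_recurrence m : Y R m.+1 / m.+1`!%:R =
  Y R m / m`!%:R * (2 / (m.+1%:R ^+ 2 * (3 * m%:R + 2))).
Proof.
rewrite /Y big_nat_recr//= factS natrM exprS.
have m2 : 3 * m.+1%:R - 1 = 3 * m%:R + 2 :> R by rewrite -natr1; ring.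
rewrite m2.
have f0 : m`!%:R != 0 :> R by rewrite pnatr_eq0 -lt0n fact_gt0.
have m0 : m.+1%:R != 0 :> R by rewrite pnatr_eq0.
have m3 : 3 * m%:R + 2 != 0 :> R by rewrite gt_eqF// ltr_wpDl// mulr_ge0.
move: f0 m0 m3; move: (\prod_(_ <= _ < _) _) (m`!%:R) (m.+1%:R) (3 * m%:R + 2).
by move=> p x y u x0 y0 u0; field; rewrite x0 y0 u0.
Qed.

Lemma Y_0 : Y R 0 / 0`!%:R = 1.
Proof. by rewrite /Y big_geq// expr0 fact0 divr1 mulr1 divr1. Qed.

(* [K * (k * (t - b)) ^+ m] is the probability that [m] more points continue a chain
   whose first vertex, at a given radius, has height [t]. *)
Lemma integral_heights m (K k b l : R) : 0 <= l ->
  (\int[lambda]_t (if (b < t < b + l)%R then (K * (k * (t - b)) ^+ m)%:E else 0) =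
   (K * k ^+ m * l ^+ m.+1 / m.+1%:R)%:E)%E.
Proof.
move=> l0.
pose p : {poly R} := (K * k ^+ m / m.+1%:R) *: ('X - b%:P) ^+ m.+1.
pose q : {poly R} := (K * k ^+ m) *: ('X - b%:P) ^+ m.
transitivity (\int[lambda]_(t in `]b, (b + l)%R[) (q.[t])%:E)%E.
  rewrite [RHS]integral_mkcond; apply: eq_integral => t _; rewrite patchE.
  rewrite mem_setE in_itv/=; case: ifP => // _; congr (_%:E).
  by rewrite /q hornerZ horner_exp hornerXsubC exprMn mulrA.
rewrite integral_itv_obnd_cbnd; last by apply/measurable_EFinP; exact: measurable_poly.
rewrite integral_itv_bndo_bndc; last by apply/measurable_EFinP; exact: measurable_poly.
rewrite (@integral_poly _ p); last 2 first.
- by rewrite lerDl.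
- rewrite /p derivZ deriv_exp derivXsubC mul1r -[X in _ *: X]scaler_nat scalerA.
  by rewrite divfK// pnatr_eq0.
rewrite /p !hornerZ !horner_exp !hornerXsubC subrr expr0n/= mulr0 subr0.
by congr (_%:E); rewrite addrAC subrr add0r mulrAC.
Qed.

(** The power r^(3 m) comes from the mass of the smaller triangle, raised to the m; one factor rho -
    r survives the integral over heights. *)
Lemma integral_radii m (k rho : R) : 0 <= rho <= 1 ->
  (\int[beta]_r (if (0 <= r < rho)%R then (k * (r ^+ (3 * m) * (rho - r)))%:E else 0) =
   (k * (2 * rho ^+ (3 * m).+3 / ((3 * m).+2%:R * (3 * m).+3%:R)))%:E)%E.
Proof.
move=> rho01.
pose q : {poly R} := k *: ('X^(3 * m) * (rho%:P - 'X)).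
pose p : {poly R} := (2 * k) *: ((rho / (3 * m).+2%:R) *: 'X^((3 * m).+2) -
  (3 * m).+3%:R^-1 *: 'X^((3 * m).+3)).
transitivity (\int[beta]_(r in `[0%R, rho]) (q.[r])%:E)%E.
  rewrite [RHS]integral_mkcond; apply: eq_integral => r _; rewrite patchE.
  rewrite mem_setE in_itv/=.
  have -> : q.[r] = k * (r ^+ (3 * m) * (rho - r)).
    by rewrite /q hornerZ hornerM hornerXn !hornerE.
  have [->|rN] := eqVneq r rho; first by rewrite ltxx andbF subrr !mulr0 if_same.
  by rewrite lt_neqAle rN.
rewrite (@integral_beta21_poly _ p)//.
  rewrite /p !hornerZ !hornerD !hornerN !hornerZ !hornerXn !expr0n/= !mulr0 subrr mulr0 subr0.
  congr (_%:E); rewrite [_ ^+ _.+3]exprS.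
  have m2 : (3 * m).+2%:R != 0 :> R by rewrite pnatr_eq0.
  have m3 : (3 * m).+3%:R != 0 :> R by rewrite pnatr_eq0.
  have e : (3 * m).+3%:R = (3 * m).+2%:R + 1 :> R by rewrite natr1.
  move: m2 m3; rewrite e; move: (_.+2%:R) => x x0 x1.
  by field; rewrite x0 x1.
rewrite /p /q derivZ derivB !derivZ !derivXn/=.
rewrite -[X in _ *: X - _]scaler_nat -[X in _ - _ *: X]scaler_nat !scalerA.
rewrite divfK ?pnatr_eq0// mulVf ?pnatr_eq0// scale1r.
rewrite -!mul_polyC !exprS; ring.
Qed.

Local Notation mplane := (plane (measurableTypeR R)).
Variable nu : probability mplane R.
Hypothesis nuE : forall B : set (plane R), measurable B ->
  B `<=` [set x | 0 <= x.2 /\ x.1 + x.2 / 3 < 1] -> nu B = (beta \x lambda)%E B.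

Definition chain_step (c rho b : R) : set mplane :=
  [set x | [&& 0 <= x.1, x.1 < rho, b < x.2 & x.2 - b < c * (rho - x.1)]].

(** c rho^3 / 3 is the integral of 2 r c (rho - r) over [0, rho], the mass of the triangle available
    to the chain. The bounds on [c] and on 3 rho + b keep this triangle where [nu] is known, and
    they pass to the next vertex. *)
Lemma chain_probability m d (T : measurableType d) (P : probability T R)
    (W : {mfun T >-> m.-tuple mplane}) (c rho b : R) :
  iid_tuple nu P W -> 0 <= c <= 3 -> 0 <= rho -> 0 <= b -> 3 * rho + b <= 3 ->
  P [set w | chain c rho b (W w)] = (Y R m / m`!%:R * (c * rho ^+ 3 / 3) ^+ m)%:E.
Proof.
elim: m W c rho b => [|m IH] W c rho b iW c03 rho0 b0 rhob.
  rewrite Y_0 mul1r expr0 -(@probability_setT _ _ _ P); congr (P _).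
  by apply/seteqP; split=> // w _ /=; rewrite tuple0.
set K := Y R m / m`!%:R in IH *.
pose E := [set xy : mplane * m.-tuple mplane | chain c rho b [tuple of xy.1 :: xy.2]].
have mE : measurable E.
  apply: (measurable_chain (W := fun xy : mplane * m.-tuple mplane =>
    [tuple of xy.1 :: xy.2])) => //.
  exact: measurable_cons.
rewrite (_ : [set w | _] = (fun w => (tuple_head W w, tuple_tail W w)) @^-1` E); last first.
  by apply/seteqP; split=> w /=; rewrite {1}[W w]tuple_eta.
rewrite (head_tail_law iW mE) /product_measure1.
pose L := distribution P (tuple_tail W).
(* The induction hypothesis at slope (x.2 - b) / (rho - x.1) and radius x.1, rearranged as a power
   of x.2 - b for [integral_heights]. *)
pose g (x : mplane) : \bar R := if x \in chain_step c rho b then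
  (K * (x.1 ^+ 3 / (3 * (rho - x.1)) * (x.2 - b)) ^+ m)%:E else 0%E.
have gE x : L (xsection E x) = g x.
  rewrite /g; case: ifPn; rewrite ?inE ?notin_setE /chain_step/= => xD.
    have [x1 x1r bx xc] := and4P xD.
    have r0 : 0 < rho - x.1 by rewrite subr_gt0.
    transitivity (P [set w | chain ((x.2 - b) / (rho - x.1)) x.1 x.2 (tuple_tail W w)]).
      rewrite /L /distribution /pushforward; congr (P _).
      apply/seteqP; split=> w; rewrite /xsection/= inE /E/= x1 x1r bx xc//=.
    have xbc : (x.2 - b) / (rho - x.1) < c by rewrite ltr_pdivrMr.
    have [c0 c3] := andP c03.
    rewrite IH//.
    - by congr (_%:E); congr (_ * _ ^+ _); field; rewrite gt_eqF.
    - exact: iid_tail.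
    - by rewrite divr_ge0 ?(ltW r0)//= ?(le_trans (ltW xbc))// subr_ge0 ltW.
    - by rewrite (le_trans b0)// ltW.
    - have : c * (rho - x.1) <= 3 * (rho - x.1) by rewrite ler_wpM2r// ltW.
      by move: rhob xc; lra.
  rewrite (_ : xsection _ _ = set0) ?measure0//.
  apply/seteqP; split=> // y; rewrite /xsection/= inE /E/=.
  by case/and5P => *; apply: xD; apply/and4P.
under eq_integral do rewrite /= -/L gE.
have mg : measurable_fun setT g.
  rewrite (_ : g = L \o xsection E); first exact: measurable_fun_xsection.
  by apply/funext => x /=; rewrite gE.
have g0 x : (0 <= g x)%E by rewrite -gE.
have gD (mu : {measure set mplane -> \bar R}) :
    (\int[mu]_x g x = \int[mu]_(x in chain_step c rho b) g x)%E.
  rewrite [RHS]integral_mkcond; apply: eq_integral => x _.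
  by rewrite patchE /g; case: ifP.
(* [nu] is only known inside the open triangle, so the integral is restricted to the support of [g]
   before the measure is exchanged. *)
rewrite gD (@eq_measure_integral _ _ _ _ (beta \x lambda)%E); last first.
  move=> B mB BD; apply: nuE => // x /BD /and4P[x1 x1r bx xc]; split.
    by rewrite (le_trans b0)// ltW.
  have [c0 c3] := andP c03.
  have : c * (rho - x.1) <= 3 * (rho - x.1) by rewrite ler_wpM2r// subr_ge0 ltW.
  by move: rhob xc; lra.
rewrite -gD (@fubini_tonelli1 _ _ _ _ R beta lambda g)//.
transitivity (\int[beta]_r (if (0 <= r < rho)%R then
  (K * c ^+ m.+1 / (3 ^+ m * m.+1%:R) * (r ^+ (3 * m) * (rho - r)))%:E else 0))%E.
  apply: eq_integral => r _; rewrite /fubini_F; case: ifP => [/andP[r0 rr]|rN].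
    have d0 : 0 < rho - r by rewrite subr_gt0.
    have [c0 c3] := andP c03.
    transitivity (\int[lambda]_t (if (b < t < b + c * (rho - r))%R then
        (K * (r ^+ 3 / (3 * (rho - r)) * (t - b)) ^+ m)%:E else 0))%E.
      apply: eq_integral => t _; rewrite /g.
      suff -> : ((r, t) \in chain_step c rho b) = (b < t < b + c * (rho - r)) by [].
      by apply/idP/idP; rewrite inE /chain_step/= r0 rr/= ltrBlDl.
    rewrite integral_heights; last by rewrite mulr_ge0// ltW.
    congr (_%:E); rewrite exprM !exprMn exprVn !exprMn [(rho - r) ^+ m.+1]exprS.
    have dm : (rho - r) ^+ m != 0 by rewrite expf_neq0// gt_eqF.
    have tm : 3 ^+ m != 0 :> R by rewrite expf_neq0// pnatr_eq0.
    have m0 : m.+1%:R != 0 :> R by rewrite pnatr_eq0.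
    move: dm tm m0; move: ((rho - r) ^+ m) (3 ^+ m) (m.+1%:R) => u v w u0 v0 w0.
    by field; rewrite u0 v0 w0.
  rewrite integral0_eq// => t _; rewrite /g; case: ifPn => //; rewrite inE /chain_step/=.
  by move=> /and4P[r0 rr _ _]; rewrite r0 rr in rN.
rewrite integral_radii; last by rewrite rho0; lra.
rewrite Y_recurrence -/K; congr (_%:E).
have e3 : ((3 * m).+3 = 3 * m.+1)%N by rewrite mulnS.
have e2 : (3 * m).+2%:R = 3 * m%:R + 2 :> R by rewrite -natrM -natrD addn2.
rewrite e3 e2 exprM natrM !exprMn exprVn [3 ^+ m.+1]exprS.
have m2 : 3 * m%:R + 2 != 0 :> R by rewrite -e2 pnatr_eq0.
have tm : 3 ^+ m != 0 :> R by rewrite expf_neq0// pnatr_eq0.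
have m0 : m.+1%:R != 0 :> R by rewrite pnatr_eq0.
move: m2 tm m0; move: (3 * m%:R + 2) (3 ^+ m) (m.+1%:R) => u v w u0 v0 w0.
by field; rewrite u0 v0 w0.
Qed.

End ChainIntegral.

(** * From chains to convex position *)

Section ChainGeometry.
Context {R : realType}.

(** The tail lies under the line of slope k through its start [y]; that line also passes through
    (rho, b), and k <= c. *)
Lemma chain_below (c rho b : R) s : chain c rho b s ->
  forall x, x \in s -> x.1 < rho /\ x.2 + c * x.1 <= b + c * rho.
Proof.
elim: s c rho b => [|y s IH] c rho b //= /and5P[y1 y1r by2 y2c ys] x.
have r0 : 0 < rho - y.1 by rewrite subr_gt0.
set k := (y.2 - b) / (rho - y.1) in ys.
have kE : k * (rho - y.1) = y.2 - b by rewrite divfK// gt_eqF.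
have kc : k <= c by rewrite ler_pdivrMr// ltW.
rewrite inE => /predU1P[->|xs]; first by split=> //; lra.
have [xy xk] := IH _ _ _ ys x xs; have xr := lt_trans xy y1r; split=> //.
by have := ler_wpM2r (ltW (_ : 0 < rho - x.1)) kc; rewrite subr_gt0 => /(_ xr); lra.
Qed.

(** [m] is the slope of the edge arriving at [x]: later points lie under its prolongation by
    [chain_below], earlier ones by concavity. Including the starting vertex carries the induction,
    and from (1, 0) it later accounts for the floor. *)
Lemma chain_support (c rho b : R) s : chain c rho b s ->
  forall x, x \in s -> exists m, [/\ 0 <= m <= c, b + m * rho <= x.2 + m * x.1 &
    forall y, y \in s -> y.2 + m * y.1 <= x.2 + m * x.1].
Proof.
elim: s c rho b => [|y s IH] c rho b //= /and5P[y1 y1r by2 y2c ys] x.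
have r0 : 0 < rho - y.1 by rewrite subr_gt0.
set k := (y.2 - b) / (rho - y.1) in ys.
have kE : k * (rho - y.1) = y.2 - b by rewrite divfK// gt_eqF.
have kc : k <= c by rewrite ler_pdivrMr// ltW.
have k0 : 0 <= k by rewrite divr_ge0 ?subr_ge0// ltW.
rewrite inE => /predU1P[->|xs].
  exists k; split; [by rewrite k0|lra|].
  by move=> v /predU1P[->//|/(chain_below ys)[]].
have [m [/andP[m0 mk] ym sm]] := IH _ _ _ ys x xs.
exists m; split; first by rewrite m0 (le_trans mk).
  by have := ler_wpM2r (ltW r0) mk; lra.
by move=> v /predU1P[->//|/sm].
Qed.

Lemma chain_path (c rho b : R) s : chain c rho b s -> path <%R b [seq x.2 | x <- s].
Proof.
by elim: s c rho b => [|y s IH] c rho b //= /and5P[_ _ -> _ /IH].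
Qed.

Variables (F : set (plane R)) (o : plane R) (z : space R).
Hypotheses (Fo : F o) (vF : convex_set F) (cF : compact F).

(* All the points lie in the convex set [v.2 + m * gauge v <= t] where [t] is the
   value at [u i]; it is phrased with dilates since the gauge need not be attained. *)
Lemma boundary_of_support n (u : 'I_n -> space R) (i : 'I_n) (m : R) :
  (forall j, (chart F o z (u j)).1 < 1) -> 0 <= m ->
  m <= (chart F o z (u i)).2 + m * (chart F o z (u i)).1 ->
  (forall j, (chart F o z (u j)).2 + m * (chart F o z (u j)).1 <=
             (chart F o z (u i)).2 + m * (chart F o z (u i)).1) ->
  boundary (convex_hull (range u `|` at_ground F)) (u i).
Proof.
move=> u1 m0 mt ut; set t := (_ + _) in mt ut.
split; first by apply: subset_closure; apply: sub_convex_hull; left; exists i.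
pose K : set (space R) := [set v | forall e, 0 < e ->
  exists2 s, 0 < s /\ F (dilate o s (off_axis o z v)) & v.2 + m * s <= t + e].
have hullK : convex_hull (range u `|` at_ground F) `<=` K.
  apply: convex_hull_sub.
    apply/convex_setP => v w l l0 l1 Kv Kw e e0.
    have [s [s0 Fs] vs] := Kv e e0; have [r [r0 Fr] wr] := Kw e e0.
    exists (l * s + (1 - l) * r); last first.
      have := ler_wpM2l l0 vs; have := ler_wpM2l (_ : 0 <= 1 - l) wr.
      rewrite subr_ge0 => /(_ l1) h1 h2.
      have -> : (l *: v + (1 - l) *: w).2 = l * v.2 + (1 - l) * w.2 by [].
      by lra.
    split.
      have [->|lN0] := eqVneq l 0; first by rewrite mul0r subr0 mul1r add0r.
      by apply: ltr_pwDl; [rewrite mulr_gt0// lt0r lN0|rewrite mulr_ge0 ?subr_ge0// ltW].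
    have := dilate_convex vF s0 r0 (_ : 0 <= l <= 1) Fs Fr; rewrite l0 l1 => /(_ isT).
    congr (F (dilate _ _ _)); rewrite /off_axis/= /GRing.scale/=.
    by congr (_, _); field.
  move=> x [[j _ <-] e e0|[/= Fv v0] e e0].
    pose g := gauge F o (off_axis o z (u j)).
    have g1 : g < 1 by exact: (u1 j).
    have d0 : 0 < e / (m + 1) by rewrite divr_gt0// ltr_wpDl.
    (* A slack of e / (m + 1) in the scale costs at most e once multiplied by [m]; the minimum with
       2 serves [gauge_lt]. *)
    have gs : g < Num.min 2 (g + e / (m + 1)) by rewrite lt_min; lra.
    have [|s /andP[s0 ss] Fs] := gauge_lt gs; first by rewrite ge_min lexx.
    exists s => //; move: ss; rewrite lt_min => /andP[_ sg].
    have : m * s <= m * g + e.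
      have := ler_wpM2l m0 (ltW sg); rewrite mulrDr => h.
      have : m * (e / (m + 1)) <= e.
        by rewrite mulrA ler_pdivrMr ?ltr_wpDl// mulrC ler_wpM2l// ?lerDl// ltW.
      by lra.
    by have := ut j; rewrite /= -/g; lra.
  (* Floor points have scale 1 and height 0, hence value [m], which [mt] bounds by [t]. *)
  exists 1; last by rewrite v0; lra.
  split=> //; rewrite /dilate /off_axis/= v0.
  by move: Fv; congr F; rewrite [LHS]surjective_pairing; congr (_, _); field.
move=> /(interiorS hullK)/nbhs_ballP[d /= d0 dK].
(* The axis direction per unit of height: a move by [h *: v] keeps the gauge and raises the height
   by [h], so it leaves [K], as tolerance h / 2 shows. *)
pose v : space R := ((z.1.1 - o.1) / 3, (z.1.2 - o.2) / 3, 1).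
pose h := d / (`|v| + 1).
have v0 : 0 < `|v| + 1 by rewrite ltr_wpDl.
have h0 : 0 < h by rewrite divr_gt0.
have /dK/(_ (h / 2))[|s [s0 Fs] us] : ball (u i) d (u i + h *: v).
- rewrite -ball_normE /= opprD addrA subrr sub0r normrN normrZ gtr0_norm//.
  by rewrite /h mulrAC ltr_pdivrMr// ltr_pM2l// ltrDl.
- by rewrite divr_gt0.
have axis : off_axis o z (u i + h *: v) = off_axis o z (u i).
  by rewrite /off_axis/= /GRing.scale/= /v/=; congr (_, _); field.
rewrite axis in Fs; have gs := gauge_le s0 Fs.
have := ler_wpM2l m0 gs; move: us; rewrite /t /=.
have -> : (h *: (1 : R) : R) = h by rewrite /GRing.scale/= mulr1.
by lra.
Qed.

End ChainGeometry.

Section EventMeasurability.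
Context {R : realType} {d : measure_display} {T : measurableType d}.

(** Each point lies in the hull, so being on its boundary means not being interior; interiority is
    open in the coordinates by [interior_convex_hull_stable]. *)
Lemma measurable_convex_position (F : set (plane R)) n (U : 'I_n -> T -> space R) :
  compact F -> convex_set F -> F !=set0 -> (forall i, measurable_fun setT (U i)) ->
  measurable [set w | in_convex_position_above F (fun i => U i w)].
Proof.
move=> cF vF [q Fq] mU.
pose inner i := [set w | interior (convex_hull (range (fun j => U j w) `|` at_ground F)) (U i w)].
have -> : [set w | in_convex_position_above F (fun i => U i w)] =
    ~` \bigcup_(i in [set` [set: 'I_n]%SET]) inner i.
  apply/seteqP; split=> w /=.
    by move=> H [i _ wi]; have [_] := H i; exact.
  move=> H i; split; last by move=> wi; apply: H; exists i => //=; rewrite inE.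
  by apply: subset_closure; apply: sub_convex_hull; left; exists i.
apply: measurableC; apply: fin_bigcup_measurable; first exact: finite_finset.
move=> i _; pose X (jk : 'I_n * option bool) w := space_coord jk.2 (U jk.1 w).
have mX jk : measurable_fun setT (X jk).
  by apply: (measurableT_comp (measurable_space_coord jk.2)); exact: mU.
apply: (measurable_open_wrt mX) => w wi.
have [|||e e0 He] := interior_convex_hull_stable _ _ _ wi.
- exact: at_ground_compact.
- exact: at_ground_convex.
- by exists (q, 0).
exists e => // w' ww'; apply: He => j; apply: norm_coord_lt => k.
exact: (ww' (j, k)).
Qed.

End EventMeasurability.

Definition mfun_of d d' (T : measurableType d) (A : measurableType d') (f : T -> A)
  (mf : measurable_fun setT f) : {mfun T >-> A} :=
  HB.pack f (isMeasurableFun.Build _ _ _ _ f mf).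

(** * The disjoint orders and the bound *)

Section ChainOrders.
Context {R : realType} {d : measure_display} {T : measurableType d}.
Variables (P : probability T R) (F : set (plane R)) (o : plane R) (z : space R) (n : nat).
Variable U : 'I_n.+1 -> {RV P >-> space R}.
Hypotheses (Fo : F o) (vF : convex_set F) (cF : compact F) (aF : area F = 1%E).
Hypothesis z3 : z.2 = 3.
Hypotheses (indU : mutually_independent U).
Hypothesis unifU : forall i, uniform_in (mountain F z) (U i).
Local Notation mplane := (plane (measurableTypeR R)).
Local Notation beta := (@beta_prob R 2 1).
Local Notation lambda := (@lebesgue_measure R).

Let X i : {mfun T >-> mplane} :=
  mfun_of (measurableT_comp (measurable_chart z Fo vF cF) (measurable_funPT (U i))
    : measurable_fun setT (fun w => chart F o z (U i w) : mplane)).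

Let nu : probability mplane R := distribution P (X ord0).

Let X_law i B : measurable B -> P (X i @^-1` B) = nu B.
Proof.
move=> mB; have mC : measurable (chart F o z @^-1` B).
  by rewrite -[Y in measurable Y]setTI; exact: measurable_chart.
transitivity (distribution P (U i) (chart F o z @^-1` B)); first by [].
by rewrite unifU// -(unifU ord0 mC).
Qed.

Let nuE (B : set (plane R)) : measurable B ->
  B `<=` [set x | 0 <= x.2 /\ x.1 + x.2 / 3 < 1] -> nu B = (beta \x lambda)%E B.
Proof.
move=> mB BT; have mC : measurable (chart F o z @^-1` B).
  by rewrite -[Y in measurable Y]setTI; exact: measurable_chart.
transitivity (distribution P (U ord0) (chart F o z @^-1` B)); first by [].
by rewrite unifU// (volume_mountain Fo vF cF aF z3) inve1 mule1; exact: chart_law.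
Qed.

Let order_fun (s : 'S_n.+1) (w : T) : n.+1.-tuple mplane := [tuple X (s i) w | i < n.+1].

Let measurable_order s : measurable_fun setT (order_fun s).
Proof.
apply/measurable_fun_tnthP => i.
rewrite (_ : _ \o _ = X (s i)) ?measurable_funPT//.
by apply/funext => w /=; rewrite tnth_mktuple.
Qed.

Let order s := mfun_of (measurable_order s).

Let iid_order s : iid_tuple nu P (order s).
Proof.
(* Point [j] occupies place s^-1 j of the list. *)
move=> B mB; pose A j := chart F o z @^-1` B (s^-1 j)%g.
have mA j : measurable (A j).
  by rewrite /A -[Y in measurable Y]setTI; apply: (measurable_chart z Fo vF cF) => //; exact: mB.
transitivity (P (\bigcap_(j in [set` [set: 'I_n.+1]%SET]) U j @^-1` A j)).
  congr (P _); apply/seteqP; split=> w /=.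
    by move=> Bw j _; have := Bw (s^-1 j)%g; rewrite tnth_mktuple permKV.
  by move=> Aw i; rewrite tnth_mktuple; have := Aw (s i); rewrite /A permK; apply;
    rewrite /= inE.
rewrite indU// (reindex_inj (@perm_inj _ s)); apply: eq_big => [i|i _]; first by rewrite inE.
by rewrite /A permK; exact: X_law.
Qed.

(** The start (1, 0) is the rim of the floor, and slope 3 is that of the side t = 3 (1 - r) of the
    mountain; the triangle has mass 1. *)
Let good s : set T := [set w | chain 3 1 0 (order s w)].

Let measurable_good s : measurable (good s).
Proof. by apply: (measurable_chain (W := order s)) => //; exact: measurable_order. Qed.

Let P_good s : P (good s) = (Y R n.+1 / n.+1`!%:R)%:E.
Proof.
rewrite /good (chain_probability nuE (iid_order s)); [|lra|lra|lra|lra].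
by rewrite expr1n mulr1 divff ?pnatr_eq0// expr1n mulr1.
Qed.

Let good_heights s w : good s w ->
  sorted <%R [seq (U (s i) w).2 | i <- enum 'I_n.+1].
Proof.
move=> /chain_path/path_sorted; congr sorted.
by rewrite /order/= /order_fun -map_comp.
Qed.

(** Two strictly sorted lists with the same elements coincide, and distinct heights identify the
    points. *)
Let good_inj s t w : good s w -> good t w -> s = t.
Proof.
move=> /[dup] gs /good_heights hs /good_heights ht.
have mem_heights (r : 'S_n.+1) : [seq (U (r i) w).2 | i <- enum 'I_n.+1] =i
    [seq (U i w).2 | i <- enum 'I_n.+1].
  move=> x; apply/mapP/mapP => -[i _ ->]; [exists (r i)|exists (r^-1 i)%g];
    by rewrite ?mem_enum ?permKV.
have hst : [seq (U (s i) w).2 | i <- enum 'I_n.+1] =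
           [seq (U (t i) w).2 | i <- enum 'I_n.+1].
  by apply: lt_sorted_eq => // x; rewrite !mem_heights.
have inj_h : injective (fun i => (U i w).2).
  have : uniq [seq (U (s i) w).2 | i <- enum 'I_n.+1] by exact: lt_sorted_uniq.
  move=> /injectiveP inj_s i j ij; rewrite -(permKV s i) -(permKV s j); congr (s _).
  by apply: inj_s; rewrite !permKV.
apply/permP => i; apply: inj_h.
by have /eq_in_map/(_ i) := hst; rewrite mem_enum; exact.
Qed.

Let good_convex s w : good s w -> in_convex_position_above F (fun i => U i w).
Proof.
move=> gs i.
have inX j : (chart F o z (U j w) : mplane) \in (order s w : seq _).
  apply/tnthP; exists (s^-1 j)%g; rewrite tnth_mktuple permKV.
  by [].
have [m [/andP[m0 _] mi Xm]] := chain_support gs (inX i).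
apply: (boundary_of_support (o := o) (z := z) vF (m := m)) => //.
- by move=> j; have [] := chain_below gs (inX j).
- by move: mi; rewrite add0r mulr1.
- by move=> j; exact: Xm.
Qed.

(** There are (n + 1)! disjoint events of probability Y_(n+1) / (n + 1)!. The number of points is a
    successor because [nu] is the law of the point [ord0]. *)
Lemma Qprob_ge_succ : ((Y R n.+1)%:E <= Qprob F U)%E.
Proof.
pose Q := [set w | in_convex_position_above F (fun i => U i w)].
have mQ : measurable Q.
  by apply: measurable_convex_position => //; exists o.
pose G (k : 'I_#|{: 'S_n.+1}|) := good (enum_val k).
have -> : ((Y R n.+1)%:E = P (\big[setU/set0]_(k < #|{: 'S_n.+1}|) G k))%E.
  rewrite measure_bigsetU_ord; last 2 first.
  - by move=> k; exact: measurable_good.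
  - by move=> k l _ _ [w [gk gl]]; apply: enum_val_inj; exact: good_inj gk gl.
  rewrite (eq_bigr (fun=> (Y R n.+1 / n.+1`!%:R)%:E)); last by move=> k _; exact: P_good.
  rewrite sumEFin sumr_const card_ord; congr (_%:E).
  by rewrite card_Sn -[RHS]mulr_natr divfK// pnatr_eq0 -lt0n fact_gt0.
apply: le_measure; rewrite ?inE//; first by apply: bigsetU_measurable => k _; exact: measurable_good.
rewrite -bigcup_seq; apply: bigcup_sub => k _ w; exact: good_convex.
Qed.

End ChainOrders.

Theorem theorem6 (R : realType) (F : set (plane R)) (z : space R) (n : nat)
    (d : measure_display) (T : measurableType d) (P : probability T R)
    (U : 'I_n -> {RV P >-> space R}) :
  compact F -> convex_set F -> area F = 1%E ->
  z.2 = 3 ->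
  mutually_independent U ->
  (forall i, uniform_in (mountain F z) (U i)) ->
  ((Y R n)%:E <= Qprob F U)%E.
Proof.
move=> cF vF aF z3 indU unifU.
(* Area 1 makes the floor nonempty, which provides the foot of the axis. *)
have [F0|/set0P[q Fq]] := eqVneq F set0.
  have := measure0 (@plane_measure R); rewrite -F0 /plane_measure => h.
  by move: aF; rewrite /area h => /eqP; rewrite eqe eq_sym oner_eq0.
case: n => [|n] in U indU unifU *; last first.
  exact: (Qprob_ge_succ Fq vF cF aF z3 indU unifU).
(* Without points the condition is vacuous: the event is the whole space and Y_0 = 1. *)
have := @Y_0 R; rewrite fact0 divr1 => ->.
rewrite -(@probability_setT _ _ _ P) /Qprob le_eqVlt; apply/orP; left; apply/eqP.
by congr (P _); apply/seteqP; split=> // w _ [].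
Qed.
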